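(* Let $S\subseteq\mathbb{F}_2^n$ be a Sidon set. Then $S$ is a $k$-cover if and only if $\widehat{1_S}(a)\in\{0,\pm\mathcal{L}(S)\}$ for all $a\in\mathbb{F}_2^n\setminus\{0\}$.
   Context: A set $S\subseteq\mathbb{F}_2^n$ is a Sidon set if whenever $a+b=c+d$ with $a,b,c,d\in S$, $a\neq b$, $c\neq d$, then $\{a,b\}=\{c,d\}$. For $p\notin S$, $\mathrm{mult}_S(p)$ is the number of $3$-element subsets $\{x,y,z\}\subseteq S$ with $x+y+z=p$. A Sidon set $S$ is a $k$-cover if there is an integer $k>0$ with $\mathrm{mult}_S(p)=k$ for all $p\in\mathbb{F}_2^n\setminus S$. $\widehat{1_S}(a)=\sum_{x\in S}(-1)^{x\cdot a}$ (standard dot product), and $\mathcal{L}(S)=\max_{a\neq 0}|\widehat{1_S}(a)|$.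
   Formalization: The formal theorem adds that S has at least 3 elements unless S is all of F_2^n; otherwise the claim fails, e.g. S={0} in F_2^1 has Fourier values 0, ±L(S) but all multiplicities outside S are 0, so it is no k-cover with k>0. *)

(* Defs.v *)
From HB Require Import structures.
From mathcomp Require Import all_boot all_order all_algebra.

Set Implicit Arguments.
Unset Strict Implicit.
Unset Printing Implicit Defensive.

Import Order.TTheory GRing.Theory Num.Theory.
Local Open Scope ring_scope.

Definition sidon (n : nat) (S : {set 'rV['F_2]_n}) : Prop :=
  forall a b c d : 'rV['F_2]_n,
    a \in S -> b \in S -> c \in S -> d \in S ->
    a + b = c + d -> a != b -> c != d -> [set a; b] = [set c; d].

Definition mult (n : nat) (S : {set 'rV['F_2]_n}) (p : 'rV['F_2]_n) : nat :=
  #|[set T : {set 'rV['F_2]_n} |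
      [&& T \subset S, #|T| == 3%N & \sum_(x in T) x == p]]|.

Definition k_cover (n : nat) (k : nat) (S : {set 'rV['F_2]_n}) : Prop :=
  (0 < k)%N /\ forall p : 'rV['F_2]_n, p \notin S -> mult S p = k.

Definition dot (n : nat) (x a : 'rV['F_2]_n) : 'F_2 :=
  \sum_(i < n) x 0 i * a 0 i.

(* The exponent is the representative of [dot x a] in {0, 1}, through the     *)
(* coercion of 'F_2 to nat.                                                   *)
Definition fourier (n : nat) (S : {set 'rV['F_2]_n}) (a : 'rV['F_2]_n) : int :=
  \sum_(x in S) (-1) ^+ (dot x a : nat).

(* For n = 0 the maximum ranges over the empty set and is 0.                  *)
Definition linearity (n : nat) (S : {set 'rV['F_2]_n}) : nat :=
  \max_(a : 'rV['F_2]_n | a != 0) `|fourier S a|%N.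

(* Main.v *)
Require Import Defs.
From mathcomp Require Import all_boot all_order all_algebra.
From mathcomp Require Import ring.

Import Order.TTheory GRing.Theory Num.Theory.
Local Open Scope ring_scope.

(** Let [N p] count the ordered triples of points of [S] with sum [p], so that
    the Fourier transform of [N] is the cube of that of [1_S].  If [p] is not
    in [S], the entries of such a triple are distinct and [N p = 6 mult p]; if
    [p] is in [S], the Sidon property leaves only the triples made of [p] and a
    repeated point, and [N p = 3|S| - 2].  Hence [S] has constant multiplicity
    off [S] iff [N] is an affine function [u + c 1_S] of the indicator, i.e. iff
    the transform [F] of [1_S] satisfies [F^3 = c F] away from 0.
    Three distinct points of [S] sum to a point off [S], which makes the constant
    multiplicity positive. *)

(** * Additive characters of the binary vector space *)

Definition chi {n : nat} (x a : 'rV['F_2]_n) : int := (-1) ^+ (dot x a : nat).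

Lemma dotC {n : nat} (x y : 'rV['F_2]_n) : dot x y = dot y x.
Proof. by apply: eq_bigr => i _; rewrite mulrC. Qed.

Lemma dotDl {n : nat} (x y a : 'rV['F_2]_n) : dot (x + y) a = dot x a + dot y a.
Proof. by rewrite -big_split; apply: eq_bigr => i _; rewrite mxE mulrDl. Qed.

Lemma F2_cases (u : 'F_2) : u = 0 \/ u = 1.
Proof.
by case: u => [[|[|m]] lt_m]; [left|right|]; try exact: val_inj.
Qed.

Lemma signF2D (u v : 'F_2) :
  (-1) ^+ ((u + v)%R : nat) = (-1) ^+ (u : nat) * (-1) ^+ (v : nat) :> int.
Proof. by case: (F2_cases u) => ->; case: (F2_cases v) => ->. Qed.

Lemma chiC {n : nat} (x a : 'rV['F_2]_n) : chi x a = chi a x.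
Proof. by rewrite /chi dotC. Qed.

Lemma chiDl {n : nat} (x y a : 'rV['F_2]_n) : chi (x + y) a = chi x a * chi y a.
Proof. by rewrite /chi dotDl signF2D. Qed.

Lemma chi0l {n : nat} (a : 'rV['F_2]_n) : chi 0 a = 1.
Proof. by rewrite /chi /dot big1 // => i _; rewrite mxE mul0r. Qed.

Lemma addvv {n : nat} (x : 'rV['F_2]_n) : x + x = 0.
Proof.
by apply/rowP => i; rewrite !mxE; case: (F2_cases (x 0 i)) => ->; apply: val_inj.
Qed.

Lemma oppv {n : nat} (x : 'rV['F_2]_n) : - x = x.
Proof. by apply/eqP; rewrite eq_sym -addr_eq0 addvv. Qed.

Lemma sum_chi {n : nat} (x : 'rV['F_2]_n) :
  \sum_a chi x a = if x == 0 then #|{: 'rV['F_2]_n}|%:R else 0.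
Proof.
case: eqP => [->|/eqP x_neq0].
  by under eq_bigr do rewrite chi0l; rewrite sumr_const.
have [i xi1] : exists i, x 0 i = 1.
  have [i xi] : exists i, x 0 i != 0 by apply/rV0Pn.
  by exists i; case: (F2_cases (x 0 i)) xi => ->.
have chi_e : chi (delta_mx 0 i) x = -1.
  rewrite /chi /dot (bigD1 i) //= big1 => [|j ji]; first by rewrite mxE !eqxx xi1.
  by rewrite mxE (negPf ji) andbF mul0r.
(* Translating the summation variable by the i-th basis vector negates the sum *)
have: \sum_a chi x a = - \sum_a chi x a.
  rewrite {1}(reindex_inj (addIr (delta_mx 0 i))) -sumrN /=.
  by apply: eq_bigr => a _; rewrite chiC chiDl chi_e mulrN1 chiC.
by move/eqP; rewrite -addr_eq0 -mulr2n mulrn_eq0 => /eqP.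
Qed.

(** Fourier inversion at [p]: in the double sum over [q] and [a], summing over [a] first isolates
    [q = p], while summing over [q] first leaves only [a = 0], whose term does not depend on [p]. *)
Lemma eq_const_fourier {n : nat} (g : 'rV['F_2]_n -> int) :
  (forall a, a != 0 -> \sum_p g p * chi p a = 0) -> forall p q, g p = g q.
Proof.
move=> g_hat.
suff inv p : g p * #|{: 'rV['F_2]_n}|%:R = \sum_p g p.
  move=> p q; have card_neq0 : #|{: 'rV['F_2]_n}|%:R != 0 :> int.
    by rewrite pnatr_eq0 -lt0n; apply/card_gt0P; exists 0.
  by apply: (mulIf card_neq0); rewrite !inv.
transitivity (\sum_q \sum_a g q * chi q a * chi p a).
  rewrite (bigD1 p) //= [X in _ + X]big1 ?addr0 => [|q q_p].
    transitivity (g p * \sum_a chi (p + p) a); first by rewrite sum_chi addvv eqxx.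
    by rewrite mulr_sumr; apply: eq_bigr => a _; rewrite chiDl mulrA.
  transitivity (g q * \sum_a chi (q + p) a).
    by rewrite mulr_sumr; apply: eq_bigr => a _; rewrite chiDl mulrA.
  by rewrite sum_chi addr_eq0 oppv (negPf q_p) mulr0.
rewrite exchange_big (bigD1 0) //= [X in _ + X]big1 ?addr0 => [|a a_neq0].
  by apply: eq_bigr => q _; rewrite !(chiC _ 0) !chi0l !mulr1.
by rewrite -mulr_suml g_hat ?mul0r.
Qed.

(** * Ordered triples with a given sum *)

(** A triple is stored as its first two entries, since the sum [p] forces the third. *)
Definition triples {n : nat} (S : {set 'rV['F_2]_n}) (p : 'rV['F_2]_n) :=
  [set u : 'rV['F_2]_n * 'rV['F_2]_n |
     [&& u.1 \in S, u.2 \in S & p - u.1 - u.2 \in S]].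

Lemma fourierE {n : nat} (S : {set 'rV['F_2]_n}) (a : 'rV['F_2]_n) :
  fourier S a = \sum_p (p \in S)%:R * chi p a.
Proof.
rewrite /fourier big_mkcond; apply: eq_bigr => p _.
by case: (p \in S); rewrite ?mul1r ?mul0r.
Qed.

Lemma fourier_triples {n : nat} (S : {set 'rV['F_2]_n}) (a : 'rV['F_2]_n) :
  \sum_p #|triples S p|%:R * chi p a = fourier S a ^+ 3.
Proof.
transitivity (\sum_(x in S) \sum_(y in S) \sum_p
    (p - x - y \in S)%:R * chi p a).
  under [RHS]eq_bigr do rewrite exchange_big.
  rewrite exchange_big; apply: eq_bigr => p _ /=.
  under eq_bigr do rewrite -mulr_suml.
  rewrite -mulr_suml -sum1_card natr_sum; congr (_ * _).
  rewrite pair_big /= [LHS]big_mkcond [RHS]big_mkcond; apply: eq_bigr => -[x y] _.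
  by rewrite inE /=; do 3?case: (_ \in S).
rewrite 2!exprS expr1 {1}/fourier mulr_suml; apply: eq_bigr => x _.
rewrite {1}/fourier mulr_suml mulr_sumr; apply: eq_bigr => y _.
(* Translating by [y + x] turns the third entry into the free variable, and the character splits
   into three factors. *)
rewrite fourierE !mulr_sumr (reindex_inj (addIr (y + x))) /=.
apply: eq_bigr => p _.
rewrite addrA !addrK !chiDl -/(chi x a) -/(chi y a).
by ring.
Qed.

(** With [z = p - x - y] one has [x + y = p + z]; if [x != y] then also [p != z], and the Sidon
    property puts [p] in [{x, y}]. *)
Lemma sidon_sum3 {n : nat} (S : {set 'rV['F_2]_n}) (p x y : 'rV['F_2]_n) :
  sidon S -> p \in S -> x \in S -> y \in S ->
  (p - x - y \in S) = [|| x == y, x == p | y == p].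
Proof.
move=> S_sidon Sp Sx Sy; apply/idP/idP => [Sz|].
  have [//|x_y /=] := eqVneq x y.
  have sumE : x + y = p + (p - x - y) by rewrite !addrA addvv add0r !oppv.
  have p_z : p != p - x - y.
    rewrite -subr_eq0 -addrA opprD addrA subrr add0r opprD !opprK.
    by rewrite addr_eq0 oppv.
  have: p \in [set x; y] by rewrite (S_sidon _ _ _ _ Sx Sy Sp Sz) ?set21.
  by rewrite !inE ![p == _]eq_sym.
case/or3P=> /eqP ->; first by rewrite oppv -addrA addvv addr0.
  by rewrite subrr sub0r oppv.
by rewrite addrAC subrr sub0r oppv.
Qed.

(** The first entry [x = p] leaves [y] free in [S]; any other [x] allows only [y = x] or [y = p]. *)
Lemma card_triples_in {n : nat} (S : {set 'rV['F_2]_n}) (p : 'rV['F_2]_n) :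
  sidon S -> p \in S -> #|triples S p| = (#|S| + #|S|.-1 * 2)%N.
Proof.
move=> S_sidon Sp; rewrite -sum1_card.
transitivity (\sum_(x in S) \sum_(y in S | [|| x == y, x == p | y == p]) 1)%N.
  rewrite pair_big_dep; apply: eq_bigl => -[x y]; rewrite inE /=.
  case Sx: (x \in S) => //=; case Sy: (y \in S) => //=.
  by rewrite sidon_sum3.
rewrite (bigD1 p) //=; congr (_ + _)%N.
  by rewrite -[RHS]sum1_card; apply: eq_bigl => y; rewrite eqxx orbT andbT.
rewrite (cardsD1 p S) Sp /= -sum_nat_const.
apply: eq_big => [x|x /andP[Sx x_p]]; first by rewrite !inE andbC.
rewrite sum1_card; transitivity #|[set x; p]|; last by rewrite cards2 x_p.
apply: eq_card => y; rewrite !inE [LHS]unfold_in (negPf x_p) [x == y]eq_sym.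
case: eqP => [->|_]; first by rewrite Sx.
by case: eqP => [->|_]; rewrite ?Sp ?andbF.
Qed.

Lemma sum_set3 {n : nat} (x y z : 'rV['F_2]_n) :
  x != y -> x != z -> y != z -> \sum_(t in [set x; y; z]) t = x + y + z.
Proof.
move=> xy xz yz; rewrite -setUA big_setU1 ?inE ?negb_or ?xy //=.
by rewrite big_setU1 ?inE //= big_set1 addrA.
Qed.

Lemma card_set3 {T : finType} (x y z : T) :
  x != y -> x != z -> y != z -> #|[set x; y; z]| = 3%N.
Proof.
move=> xy xz yz.
by rewrite -setUA cardsU1 !inE negb_or xy xz /= cards2 yz.
Qed.

Lemma set3_complete {n : nat} (T : {set 'rV['F_2]_n}) (x y : 'rV['F_2]_n) :
  #|T| = 3%N -> x \in T -> y \in T -> x != y ->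
  [set x; y; \sum_(t in T) t - x - y] = T.
Proof.
move=> T3 Tx Ty xy.
have Txy : y \in T :\ x by rewrite !inE eq_sym xy.
have /eqP/cards1P[z Tz] : #|T :\ x :\ y| = 1%N.
  by move: T3; rewrite (cardsD1 x) Tx (cardsD1 y (T :\ x)) Txy => -[].
have -> : \sum_(t in T) t - x - y = z.
  rewrite (big_setD1 x) //= (big_setD1 y) //= Tz big_set1.
  by rewrite [x + _]addrC addrK [y + z]addrC addrK.
by rewrite -[RHS](setD1K Tx) -(setD1K Txy) Tz setUA.
Qed.

Lemma card_offdiag {T : finType} (A : {set T}) :
  #|[set u : T * T | [&& u.1 \in A, u.2 \in A & u.1 != u.2]]|
  = (#|A| * #|A|.-1)%N.
Proof.
rewrite -sum1_card -sum_nat_const.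
transitivity (\sum_(x in A) \sum_(y in A | x != y) 1)%N.
  by rewrite pair_big_dep; apply: eq_bigl => -[x y]; rewrite inE.
apply: eq_bigr => x Ax; rewrite (cardsD1 x A) Ax /= sum1_card.
by apply: eq_card => y; rewrite !inE /= andbC eq_sym.
Qed.

(** Triples are grouped by their support [T]; the triples over [T] correspond to the ordered pairs
    of distinct points of [T], of which there are 3 * 2. *)
Lemma card_triples_notin {n : nat} (S : {set 'rV['F_2]_n}) (p : 'rV['F_2]_n) :
  p \notin S -> #|triples S p| = (mult S p * 6)%N.
Proof.
move=> Sp; rewrite /mult -sum_nat_const -sum1_card.
pose supp (u : 'rV['F_2]_n * 'rV['F_2]_n) := [set u.1; u.2; p - u.1 - u.2].
(* If two entries coincided they would cancel, and the remaining one would be [p], which is not in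
   [S]. *)
have triple_neq x y : (x, y) \in triples S p ->
    [/\ x != y, x != p - x - y & y != p - x - y].
  rewrite inE /= => /and3P[Sx Sy Sz]; split; apply: contraNneq Sp.
  - by move=> xy; rewrite xy -addrA oppv addvv addr0 in Sz.
  - move=> xz; suff -> : p = y by [].
    by apply/eqP; rewrite -subr_eq0 -(subrK x (p - y)) [p - y - x]addrAC -xz addvv.
  - move=> yz; suff -> : p = x by [].
    apply/eqP; rewrite -subr_eq0 -(subrK y (p - x)) -yz.
    by rewrite addvv.
rewrite (partition_big supp
  [in [set T : {set 'rV['F_2]_n} |
      [&& T \subset S, #|T| == 3%N & \sum_(x in T) x == p]]]) /=; last first.
  move=> [x y] u_in; have [xy xz yz] := triple_neq _ _ u_in.
  move: u_in; rewrite !inE /supp /= => /and3P[Sx Sy Sz].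
  by rewrite !subUset !sub1set Sx Sy Sz card_set3 // sum_set3 //
    -[p - x - y]addrA -opprD [x + y + _]addrC subrK !eqxx.
apply: eq_bigr => T; rewrite inE => /and3P[/subsetP TS /eqP T3 /eqP Tp].
rewrite sum1_card -[6%N]/(3 * 3.-1)%N -T3 -card_offdiag; apply: eq_card => -[x y].
rewrite [RHS]inE /= [LHS]unfold_in; apply/andP/and3P => [[u_in /eqP <-]|[Tx Ty xy]].
  have [xy _ _] := triple_neq _ _ u_in.
  by rewrite /supp /= !inE !eqxx orbT.
have TE := set3_complete T x y T3 Tx Ty xy; rewrite Tp in TE.
by rewrite /supp TE inE /= !TS // -TE !inE eqxx orbT.
Qed.

(** If the sum of three distinct points of [S] lay in [S], [sidon_sum3] would force two of them to
    coincide. *)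
Lemma sidon_mult_gt0 {n : nat} (S : {set 'rV['F_2]_n}) :
  sidon S -> (2 < #|S|)%N -> exists2 p, p \notin S & (0 < mult S p)%N.
Proof.
move=> S_sidon /card_gt2P[x [y [z [[Sx Sy Sz] [xy yz zx]]]]].
exists (x + y + z).
  apply/negP => Sp; have := sidon_sum3 S (x + y + z) x y S_sidon Sp Sx Sy.
  have -> : x + y + z - x - y = z by rewrite -addrA -opprD addrC addKr.
  have self_add (u v w : 'rV['F_2]_n) : (u == u + v + w) = (v == w).
    by rewrite -[X in X == _]addr0 -addrA (inj_eq (addrI u)) eq_sym addr_eq0 oppv.
  rewrite Sz (negPf xy) self_add (negPf yz) [x + y]addrC self_add.
  by rewrite [x == z]eq_sym (negPf zx).
apply/card_gt0P; exists [set x; y; z]; rewrite eq_sym in zx.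
by rewrite inE card_set3 // sum_set3 // !eqxx !subUset !sub1set Sx Sy Sz.
Qed.

(** * From the cubic equation to the values of the transform *)

Lemma fourier_setT {n : nat} (a : 'rV['F_2]_n) :
  a != 0 -> fourier [set: 'rV['F_2]_n] a = 0.
Proof.
move=> a_neq0; transitivity (\sum_x chi a x).
  by apply: eq_big => [x|x _]; rewrite ?inE // chiC.
by rewrite sum_chi (negPf a_neq0).
Qed.

(** All nonzero values away from 0 have square [c], hence one common absolute value, which is the
    maximum. *)
Lemma fourier_cube_linearity {n : nat} (S : {set 'rV['F_2]_n}) (c : int) :
  (forall a, a != 0 -> fourier S a ^+ 3 = c * fourier S a) ->
  forall a, a != 0 -> [\/ fourier S a = 0,
    fourier S a = (linearity S)%:Z | fourier S a = - (linearity S)%:Z].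
Proof.
move=> cube a a_neq0; have [|Fa_neq0] := eqVneq (fourier S a) 0.
  by constructor 1.
have sqr b : b != 0 -> fourier S b != 0 -> fourier S b ^+ 2 = c.
  by move=> b_neq0 Fb; apply: (mulIf Fb); rewrite -exprSr cube.
suff LE : linearity S = `|fourier S a|%N.
  rewrite LE; case: (ger0P (fourier S a)) => Fa.
    by constructor 2; rewrite gez0_abs.
  by constructor 3; rewrite ltz0_abs ?opprK.
apply/eqP; rewrite eqn_leq leq_bigmax_cond // andbT.
apply/bigmax_leqP => b b_neq0.
have [->|Fb_neq0] := eqVneq (fourier S b) 0; first by rewrite absz0.
have /eqP := sqr b b_neq0 Fb_neq0.
rewrite -(sqr a a_neq0 Fa_neq0) eqf_sqr => /orP[]/eqP -> //.
by rewrite abszN.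
Qed.

(* With fewer than three points and S not the whole space, every multiplicity
   is 0, so no k > 0 works, while the Fourier condition holds: this is
   exactly the case that [S_nondeg] excludes. *)
Theorem theorem3p5 (n : nat) (S : {set 'rV['F_2]_n})
    (S_sidon : sidon S)
    (S_nondeg : S <> [set: 'rV['F_2]_n] -> (2 < #|S|)%N) :
  (exists k : nat, k_cover k S) <->
  (forall a : 'rV['F_2]_n, a != 0 ->
     [\/ fourier S a = 0,
         fourier S a = (linearity S)%:Z
       | fourier S a = - (linearity S)%:Z]).
Proof.
(* For the whole space both sides hold: no point lies off [S], so any positive [k] serves. *)
have [ST|/eqP/S_nondeg S_gt2] := eqVneq S [set: 'rV['F_2]_n].
  split=> [_ a a_neq0|_]; first by constructor 1; rewrite ST fourier_setT.
  by exists 1%N; split=> // p; rewrite ST inE.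
split=> [[k [_ S_k]]|S_hat].
  pose m := (#|S| + #|S|.-1 * 2)%N.
  (* The triple count is [m] on [S] and [6k] off [S], that is [6k + (m - 6k) 1_S]; the constant [6k]
     has zero transform at [a != 0]. *)
  apply: (fourier_cube_linearity S (m%:R - (k * 6)%:R)) => a a_neq0.
  rewrite -fourier_triples fourierE mulr_sumr.
  transitivity (\sum_p ((m%:R - (k * 6)%:R) * ((p \in S)%:R * chi p a)
                        + (k * 6)%:R * chi p a)).
    apply: eq_bigr => p _; rewrite mulrA -mulrDl; congr (_ * _).
    have [Sp|Sp] := boolP (p \in S); first by rewrite card_triples_in // mulr1 subrK.
    by rewrite card_triples_notin // S_k // mulr0 add0r.
  rewrite big_split /= -mulr_sumr -[X in _ + X]mulr_sumr.
  under [X in _ + _ * X]eq_bigr do rewrite chiC.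
  by rewrite sum_chi (negPf a_neq0) mulr0 addr0 mulr_sumr.
have [q Sq mult_gt0] := sidon_mult_gt0 S S_sidon S_gt2.
exists (mult S q); split=> // p Sp.
(* The transform of [g] is [F^3 - L^2 F], with [F] that of [1_S] and [L] the linearity; it vanishes
   when [F] is 0 or [L] up to sign. *)
pose g p : int := #|triples S p|%:R - (linearity S)%:Z ^+ 2 * (p \in S)%:R.
have /(_ p q) : forall p q, g p = g q.
  apply: eq_const_fourier => a a_neq0.
  under eq_bigr do rewrite mulrBl -mulrA.
  rewrite sumrB fourier_triples -mulr_sumr -fourierE.
  case: (S_hat a a_neq0) => ->; first by rewrite mulr0 expr0n subrr.
    by rewrite -exprSr subrr.
  by rewrite mulrN -exprSr exprNn -signr_odd /= mulN1r subrr.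
rewrite /g (negPf Sp) (negPf Sq) !mulr0 !subr0 !card_triples_notin //.
by move/eqP; rewrite eqr_nat eqn_pmul2r // => /eqP.
Qed.
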